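(* Let $I$ be a finite set of players. For each $\nu\in I$ let $X_\nu\subset\mathbb{R}^{n_\nu}$, let $\succeq_\nu$ be a binary relation on $\mathbb{R}^n=\prod_{\nu\in I}\mathbb{R}^{n_\nu}$, and let $K_\nu:X_{-\nu}\rightrightarrows X_\nu$ be a set-valued map, where $X_{-\nu}=\prod_{j\ne\nu}X_j$. Assume that for each $\nu\in I$: (1) $X_\nu$ is non-empty, convex and compact; (2) $K_\nu$ is continuous with non-empty, closed and convex values; (3) $U^s_\nu(x)$ is convex and open for all $x\in\mathbb{R}^n$; (4) $U^s_\nu:\mathbb{R}^n\rightrightarrows\mathbb{R}^{n_\nu}$ is lower hemicontinuous. Then there exists at least one generalized Nash equilibrium.
   Context: Vectors $x\in\mathbb{R}^n$ are written $x=(x^\nu,x^{-\nu})$. The induced relation is $x^\nu\succeq_{\nu,w^{-\nu}}y^\nu$ iff $(x^\nu,w^{-\nu})\succeq_\nu(y^\nu,w^{-\nu})$, with asymmetric part $\succ_{\nu,w^{-\nu}}$ ($a\succ b$ iff $a\succeq b$ and not $b\succeq a$). $U^s_\nu(x)=\{y^\nu\in\mathbb{R}^{n_\nu}:y^\nu\succ_{\nu,x^{-\nu}}x^\nu\}$. With $X=\prod_\nu X_\nu$ and $K(x)=\prod_\nu K_\nu(x^{-\nu})$, a point $\hat x\in K(\hat x)$ is a generalized Nash equilibrium if for each $\nu\in I$ there is no $x^\nu\in K_\nu(\hat x^{-\nu})$ with $x^\nu\succ_{\nu,\hat x^{-\nu}}\hat x^\nu$. A set-valued map $F$ is upper hemicontinuous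 at $x$ if for every open $V\supset F(x)$ the set $\{z:F(z)\subset V\}$ is a neighborhood of $x$; lower hemicontinuous at $x$ if for every open $V$ with $V\cap F(x)\neq\emptyset$ the set $\{z:F(z)\cap V\ne\emptyset\}$ is a neighborhood of $x$; continuous if both, at every point. *)

(* Defs.v *)
From HB Require Import structures.
From mathcomp Require Import all_boot all_order all_algebra.
From mathcomp Require Import all_classical all_reals.
From mathcomp Require Import topology normedtype convex.
Set Implicit Arguments. Unset Strict Implicit. Unset Printing Implicit Defensive.
Import Order.TTheory GRing.Theory Num.Theory.
Import numFieldTopology.Exports.
Local Open Scope classical_set_scope.
Local Open Scope ring_scope.

(* Strategy profiles x = (x^nu)_nu in R^n = prod_nu R^{n_nu}, with the
   product topology (= Euclidean topology on R^n). *)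
Definition profile (R : realType) (I : finType) (n : I -> nat) :=
  prod_topology (fun j : I => 'rV[R]_(n j)).

Definition mprofile (R : realType) (I : finType) (n : I -> nat) (nu : I) :=
  prod_topology (fun j : {j : I | j != nu} => 'rV[R]_(n (val j))).

Definition minus (R : realType) (I : finType) (n : I -> nat)
  (x : profile R n) (nu : I) : mprofile R n nu := fun j => x (val j).

Arguments minus {R I n} x nu _.

Definition Xminus (R : realType) (I : finType) (n : I -> nat)
  (X : forall nu : I, set 'rV[R]_(n nu)) (nu : I) : set (mprofile R n nu) :=
  [set w | forall j, X (val j) (w j)].

Arguments Xminus {R I n} X nu w.

Definition replace (R : realType) (I : finType) (n : I -> nat)
  (w : profile R n) (nu : I) (y : 'rV[R]_(n nu)) : profile R n :=
  @dfwith I (fun j => 'rV[R]_(n j)) w nu y.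

Arguments replace {R I n} w nu y _.

Definition induced_weak (R : realType) (I : finType) (n : I -> nat)
  (pref : profile R n -> profile R n -> Prop) (nu : I) (w : profile R n)
  (a b : 'rV[R]_(n nu)) : Prop :=
  pref (replace w nu a) (replace w nu b).

Arguments induced_weak {R I n} pref nu w a b.

Definition induced_strict (R : realType) (I : finType) (n : I -> nat)
  (pref : profile R n -> profile R n -> Prop) (nu : I) (w : profile R n)
  (a b : 'rV[R]_(n nu)) : Prop :=
  induced_weak pref nu w a b /\ ~ induced_weak pref nu w b a.

Arguments induced_strict {R I n} pref nu w a b.

Definition Us (R : realType) (I : finType) (n : I -> nat)
  (pref : profile R n -> profile R n -> Prop) (nu : I) (x : profile R n) :
  set 'rV[R]_(n nu) :=
  [set y | induced_strict pref nu x y (x nu)].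

Arguments Us {R I n} pref nu x _.

(* Hemicontinuity of a set-valued map F : D ⇉ U, D a subset of the
   topological space T carrying the subspace topology. *)
Definition uhc_at (T U : topologicalType) (D : set T) (F : T -> set U) (x : T) :=
  forall V : set U, open V -> F x `<=` V ->
    exists N : set T, nbhs x N /\ (forall z, D z -> N z -> F z `<=` V).

Definition lhc_at (T U : topologicalType) (D : set T) (F : T -> set U) (x : T) :=
  forall V : set U, open V -> F x `&` V !=set0 ->
    exists N : set T, nbhs x N /\ (forall z, D z -> N z -> F z `&` V !=set0).

Definition uhc_on (T U : topologicalType) (D : set T) (F : T -> set U) :=
  forall x, D x -> uhc_at D F x.

Definition lhc_on (T U : topologicalType) (D : set T) (F : T -> set U) :=
  forall x, D x -> lhc_at D F x.

Definition hcontinuous_on (T U : topologicalType) (D : set T) (F : T -> set U) :=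
  uhc_on D F /\ lhc_on D F.

Definition is_GNE (R : realType) (I : finType) (n : I -> nat)
  (X : forall nu : I, set 'rV[R]_(n nu))
  (pref : forall nu : I, profile R n -> profile R n -> Prop)
  (K : forall nu : I, mprofile R n nu -> set 'rV[R]_(n nu))
  (xh : profile R n) : Prop :=
  (forall nu, X nu (xh nu)) /\
  (forall nu, K nu (minus xh nu) (xh nu)) /\
  (forall nu, ~ exists y, K nu (minus xh nu) y /\
                          induced_strict (pref nu) nu xh y (xh nu)).

(* Main.v *)
(** The strict preference maps have open graph: a convex set meeting small balls
    around the vertices of a cube contains a neighbourhood of its centre, so lower
    hemicontinuity with open convex values gives a whole ball of strictly better
    replies common to all nearby profiles.

    If there were no equilibrium, every feasible profile would have a
    neighbourhood on which one fixed player is either bounded away from his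
    constraint set or able to improve strictly.  A finite subcover by closed
    neighbourhoods then yields a map F with open lower sections whose value at z
    asks every player blamed at z to move towards a convex set not containing his
    current strategy, so that z is never in the convex hull of F z.  This
    contradicts the Fan-Browder theorem.

    The latter reduces, by compactness, to a covering lemma on the standard
    simplex: closed sets A_i covering it have a point t lying in A_i whenever
    t_i > 0.  Applied to fine grids, this is Scarf's lemma on dominant sets
    for a family of linear orders, proved by a parity argument. *)

Require Import Defs.
From HB Require Import structures.
From mathcomp Require Import all_boot all_order all_algebra.
From mathcomp Require Import all_classical all_reals.
From mathcomp Require Import topology normedtype convex interval_inference lra.
Set Implicit Arguments.
Unset Strict Implicit.
Unset Printing Implicit Defensive.
Import Order.TTheory GRing.Theory Num.Theory.
Import numFieldTopology.Exports.

(** * Scarf's lemma *)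

Section Dominance.
Import mathcomp.boot.fintype mathcomp.boot.finset.
Local Open Scope set_scope.
Variables (W I : finType) (r : I -> W -> nat).
Hypothesis r_inj : forall i, injective (r i).

Definition dominant (S : {set W}) :=
  [forall y, exists i, forall x in S, r i y <= r i x].

Lemma dominantP (S : {set W}) :
  reflect (forall y, exists i, forall x, x \in S -> r i y <= r i x)
          (dominant S).
Proof.
apply: (iffP forallP) => H y; have := H y.
  by move=> /existsP[i /forall_inP]; exists i.
by case=> i Hi; apply/existsP; exists i; apply/forall_inP.
Qed.

Lemma dominantS (S T : {set W}) : S \subset T -> dominant T -> dominant S.
Proof.
move=> /subsetP sST /dominantP dT; apply/dominantP => y.
by have [i iP] := dT y; exists i => x /sST; apply: iP.
Qed.

Variable w0 : W.

(* Meaningful only for nonempty S. *)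
Definition argmin_set (S : {set W}) i : W :=
  [arg min_(x < odflt w0 [pick x in S] in S) r i x].

Lemma argmin_setP (S : {set W}) i : S != set0 ->
  argmin_set S i \in S /\ forall x, x \in S -> r i (argmin_set S i) <= r i x.
Proof.
move=> /set0Pn[x xS]; rewrite /argmin_set; case: arg_minnP => [|y yS ymin].
  by case: pickP => //= /(_ x); rewrite xS.
by split.
Qed.

Lemma argmin_set_eq (S : {set W}) i z :
  z \in S -> (forall x, x \in S -> r i z <= r i x) -> argmin_set S i = z.
Proof.
move=> zS zmin; have /argmin_setP : S != set0 by apply/set0Pn; exists z.
move=> /(_ i)[mS mmin]; apply: (@r_inj i); apply/eqP.
by rewrite eqn_leq mmin // zmin.
Qed.

(** Testing dominance against [x] itself makes [x] minimal in some order. Hence a dominant set has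
    at most [#|I|] elements. *)
Lemma dominant_argmin (S : {set W}) x :
  dominant S -> x \in S -> exists i, argmin_set S i = x.
Proof.
by move=> /dominantP/(_ x)[i iP] xS; exists i; apply: argmin_set_eq.
Qed.

(** * Completing a dominant set of corank one *)

Section Pivot.
Variables (T : {set W}) (a b : I).
Hypotheses (T_neq0 : T != set0) (cardT : #|T|.+1 = #|I|)
  (domT : dominant T) (neq_ab : a != b)
  (eq_ab : argmin_set T a = argmin_set T b).

(** Adding such a point to [T] leaves the minimum unchanged in every order except possibly the
    [j]-th. *)
Definition beyond j : {set W} :=
  [set y | [forall i, (i != j) ==> (r i (argmin_set T i) < r i y)]].

Lemma beyondP j y :
  reflect (forall i, i != j -> r i (argmin_set T i) < r i y) (y \in beyond j).
Proof.
rewrite inE; apply: (iffP forallP) => H i; first by apply: implyP.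
by apply/implyP/H.
Qed.

(** By counting, the minima of [x |: T] match orders and elements bijectively. The order [j]
    assigned to [x] must break the collision of [a] and [b], and the other minima are those of [T].
    Dominance against a point of [beyond j] can then only use order [j]. *)
Lemma pivot_room x : x \notin T -> dominant (x |: T) ->
  exists2 j, j \in [set a; b] &
    x \in beyond j /\ forall y, y \in beyond j -> r j y <= r j x.
Proof.
move=> xT domU; set U := x |: T in domU *.
have xU : x \in U by rewrite setU11.
have U0 : U != set0 by apply/set0Pn; exists x.
have mU i : argmin_set U i \in U by have [] := argmin_setP i U0.
have imU : argmin_set U @: setT = U.
  apply/setP => z; apply/imsetP/idP => [[i _ ->]//|/(dominant_argmin domU)[i <-]].
  by exists i.
have inj : injective (argmin_set U).
  have /imset_injP inj : #|argmin_set U @: setT| == #|[set: I]|.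
    by rewrite imU cardsU1 xT add1n cardT cardsT.
  by move=> i i' e; apply: inj => //; rewrite inE.
have [j xj] := dominant_argmin domU xU.
have mT i : i != j -> argmin_set T i = argmin_set U i.
  move=> ij; apply: argmin_set_eq => [|z zT].
    have := mU i; rewrite !inE => /orP[/eqP e|//].
    by move: ij; rewrite (inj i j) ?eqxx // e xj.
  by have [_ ->//] := argmin_setP i U0; rewrite inE zT orbT.
exists j.
  rewrite !inE; apply: contraT; rewrite negb_or !(eq_sym j) => /andP[aj bj].
  by move: neq_ab; rewrite (inj a b) ?eqxx // -!mT.
split=> [|y /beyondP yM].
  apply/beyondP => i ij; rewrite mT // ltn_neqAle; have [_ ->//] := argmin_setP i U0.
  rewrite andbT; apply: contra ij => /eqP/r_inj e; apply/eqP/inj.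
  by rewrite e xj.
have /dominantP/(_ y)[i iP] := domU.
have [<-|ij] := eqVneq i j; first exact: iP.
have := yM i ij; rewrite ltnNge iP // inE.
by have [-> _] := argmin_setP i T_neq0; rewrite orbT.
Qed.

Lemma room_pivot j x : j \in [set a; b] -> x \in beyond j ->
  (forall y, y \in beyond j -> r j y <= r j x) ->
  x \notin T /\ dominant (x |: T).
Proof.
move=> jab /beyondP xM xmax; split.
  apply/negP => /(dominant_argmin domT)[i ix].
  (* A minimum attained in order [j] is also attained in the other order of the colliding pair, so
     [x] would have to exceed itself there. *)
  suff [i' i'j i'x] : exists2 i', i' != j & argmin_set T i' = x.
    by have := xM i' i'j; rewrite i'x ltnn.
  have [e|ij] := eqVneq i j; last by exists i.
  move: jab; rewrite -e !inE => /orP[]/eqP ei; rewrite ei in ix *.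
    by exists b; [rewrite eq_sym | rewrite -eq_ab].
  by exists a; [|rewrite eq_ab].
have le_jT t : t \in T -> r j x <= r j t.
  have /dominantP/(_ x)[i iP] := domT.
  have [<-|ij tT] := eqVneq i j; first exact: iP.
  by have := xM i ij; rewrite ltnNge iP //; have [->] := argmin_setP i T_neq0.
apply/dominantP => y; have [/xmax yx|] := boolP (y \in beyond j).
  exists j => z; rewrite !inE => /orP[/eqP->//|/le_jT]; exact: leq_trans.
rewrite inE negb_forall => /existsP[i]; rewrite negb_imply -leqNgt => /andP[ij le].
exists i => z; rewrite !inE => /orP[/eqP->|zT]; first exact: leq_trans le (ltnW (xM i ij)).
by apply: leq_trans le _; have [_ ->] := argmin_setP i T_neq0.
Qed.

Definition rooms_on : {set W} := [set x | (x \notin T) && dominant (x |: T)].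

(** A common point would lie above the minimum of [T] in every order, against dominance of [T]. *)
Lemma beyond_disjoint x : x \in beyond a -> x \notin beyond b.
Proof.
move=> /beyondP xa; apply/negP => /beyondP xb.
have /dominantP/(_ x)[i iP] := domT.
have : r i (argmin_set T i) < r i x.
  by have [->|] := eqVneq i a; [apply: xb | apply: xa].
by rewrite ltnNge iP //; have [->] := argmin_setP i T_neq0.
Qed.

Lemma beyond_max j : beyond j != set0 ->
  exists2 x, x \in beyond j & forall y, y \in beyond j -> r j y <= r j x.
Proof. by case/set0Pn => y0 y0M; case: (@arg_maxnP _ y0 (mem (beyond j)) (r j) y0M) => x; exists x. Qed.

Lemma beyond_max_uniq j x y :
  x \in beyond j -> (forall z, z \in beyond j -> r j z <= r j x) ->
  y \in beyond j -> (forall z, z \in beyond j -> r j z <= r j y) -> x = y.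
Proof.
move=> xM xmax yM ymax; apply: (@r_inj j); apply/eqP.
by rewrite eqn_leq ymax // xmax.
Qed.

Lemma card_rooms_on2 :
  beyond a != set0 -> beyond b != set0 -> #|rooms_on| = 2.
Proof.
move=> /beyond_max[x xM xmax] /beyond_max[y yM ymax].
suff -> : rooms_on = [set x; y].
  rewrite cards2; case: eqVneq => // e; move: yM.
  by rewrite -e (negPf (beyond_disjoint xM)).
have [ab bb] : a \in [set a; b] /\ b \in [set a; b] by rewrite !inE !eqxx orbT.
have [xT domx] := room_pivot ab xM xmax; have [yT domy] := room_pivot bb yM ymax.
apply/setP => z; rewrite [LHS]inE [RHS]inE !in_set1.
apply/andP/orP => [[zT /(pivot_room zT)[j jab [zM zmax]]]|[]/eqP->//].
move: jab; rewrite !inE => /orP[]/eqP ej; subst j; [left|right]; apply/eqP.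
  exact: (beyond_max_uniq zM zmax xM xmax).
exact: (beyond_max_uniq zM zmax yM ymax).
Qed.

Lemma card_rooms_on1 :
  beyond a != set0 -> beyond b = set0 -> #|rooms_on| = 1.
Proof.
move=> /beyond_max[x xM xmax] b0.
suff -> : rooms_on = [set x] by rewrite cards1.
have [xT domx] := @room_pivot a x (set21 _ _) xM xmax.
apply/setP => z; rewrite [LHS]inE in_set1.
apply/andP/eqP => [[zT /(pivot_room zT)[j jab [zM zmax]]]|->//].
move: jab; rewrite !inE => /orP[]/eqP ej; subst j.
  exact: (beyond_max_uniq zM zmax xM xmax).
by rewrite b0 inE in zM.
Qed.

End Pivot.

Lemma argmin_set_collision (T : {set W}) :
  T != set0 -> #|T|.+1 = #|I| ->
  exists a b, a != b /\ argmin_set T a = argmin_set T b.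
Proof.
move=> T0 cT; have /injectivePn[a [b ab e]] : ~~ injectiveb (argmin_set T).
  apply/injectiveP => inj.
  have : #|argmin_set T @: setT| <= #|T|.
    apply/subset_leq_card/subsetP => _ /imsetP[i _ ->].
    by have [] := argmin_setP i T0.
  by rewrite card_imset // cardsT -cT ltnn.
by exists a, b.
Qed.

(** * Doors, rooms and parity *)

Variables (c : W -> I) (k : I).

Definition door (T : {set W}) := (#|T|.+1 == #|I|) && (c @: T == ~: [set k]).

(** If removing [x] leaves a door, the color of [x] is not [k], since [U] misses a color; so exactly
    one other point [x'] shares it. The doors are then obtained by removing [x] or [x'], and in no
    other way. *)
Lemma even_doors (U : {set W}) : c @: U != setT ->
  2 %| #|[set x in U | door (U :\ x)]|.
Proof.
move=> nfull; set D := [set _ in _ | _].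
have [->|/set0Pn[x]] := eqVneq D set0; first by rewrite cards0.
rewrite inE => /andP[xU dx].
have inj z : door (U :\ z) -> {in U :\ z &, injective c}.
  move=> /andP[/eqP cz /eqP iz]; apply/imset_injP.
  by rewrite iz cardsC1 -cz.
have /andP[/eqP cx /eqP ix] := dx.
have cxk : c x != k.
  apply: contra nfull => /eqP cxk.
  by rewrite -(setD1K xU) imsetU1 cxk ix setUCr.
have : c x \in c @: (U :\ x) by rewrite ix !inE.
case/imsetP => x' x'U cxx'; have := x'U; rewrite !inE => /andP[x'x x'U'].
suff -> : D = [set x; x'] by rewrite cards2 eq_sym x'x.
apply/setP => z; rewrite !inE; apply/andP/orP.
  case=> zU dz; apply/orP; apply: contraT; rewrite negb_or => /andP[zx zx'].
  by case/eqP: x'x; apply: (inj z dz); rewrite ?inE ?x'U' ?xU 1?eq_sym ?zx ?zx'.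
case=> /eqP-> //; split=> //; apply/andP; split.
  by have := cardsD1 x U; rewrite (cardsD1 x' U) xU x'U' !add1n => ->; rewrite cx.
rewrite -ix; apply/eqP/setP => l; apply/imsetP/imsetP => -[u uU ->].
  have [->|ux] := eqVneq u x; first by exists x'.
  by exists u => //; move: uU; rewrite !inE ux => /andP[].
have [->|ux'] := eqVneq u x'.
  by exists x => //; rewrite !inE eq_sym x'x.
by exists u => //; move: uU; rewrite !inE ux' => /andP[].
Qed.

(** Abstract slack vectors. The point [v0] guarantees a room on the all-slack door [T0], and having
    two colors keeps doors nonempty, so that their minima make sense. *)
Variables (s : I -> W) (v0 : W).
Hypotheses (s_min : forall i x, x != s i -> r i (s i) < r i x)
  (s_max : forall i j x, i != j -> x \notin codom s -> r i x < r i (s j))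
  (v0s : v0 \notin codom s) (cs : forall i, c (s i) = i)
  (two_colors : 1 < #|I|).

Let T0 := s @: [set~ k].

Lemma s_inj : injective s. Proof. exact: can_inj cs. Qed.

Lemma door_T0 : door T0.
Proof.
have := cardsC1 k; rewrite /door card_imset; last exact: s_inj.
move=> ->; rewrite prednK ?(ltnW two_colors) // eqxx /=.
apply/eqP/setP => i; apply/imsetP/idP => [[_ /imsetP[j jk ->] ->]|ik].
  by rewrite cs.
by exists (s i); rewrite ?cs // imset_f.
Qed.

Lemma door_neq0 T : door T -> T != set0.
Proof.
move=> /andP[/eqP cT _]; apply: contraTneq two_colors => T0'.
by rewrite -cT T0' cards0.
Qed.

Lemma door_inner T : door T -> T != T0 ->
  exists2 v, v \in T & v \notin codom s.
Proof.
move=> dT TT0; apply/exists_inP; apply: contraR TT0 => /exists_inPn Ts.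
have /andP[_ /eqP cT] := dT; rewrite eqEsubset; apply/andP; split.
  apply/subsetP => x xT; have := Ts x xT; rewrite negbK => /codomP[i xi].
  by rewrite xi imset_f // -cT -(cs i) -xi imset_f.
apply/subsetP => _ /imsetP[i + ->]; rewrite -cT => /imsetP[x xT ix].
by have := Ts x xT; rewrite negbK => /codomP[j xj]; rewrite ix xj cs -xj.
Qed.

(** A dominant door other than [T0] contains a non-slack point [v]; in each order [i != j] the slack
    vector [s j] lies above [v], hence in [beyond T j]. Both pivots are therefore possible. *)
Lemma even_rooms_on T : door T -> T != T0 -> 2 %| #|rooms_on T|.
Proof.
move=> dT TT0; have [v vT vs] := door_inner dT TT0.
have [domT|ndomT] := boolP (dominant T); last first.
  rewrite (_ : rooms_on T = set0) ?cards0 //; apply/setP => x; rewrite !inE.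
  apply/negP => /andP[_] /(dominantS _) dom; move/negP: ndomT; apply.
  by apply: dom; rewrite subsetUr.
have T_neq0 := door_neq0 dT; have /andP[/eqP cT _] := dT.
have [a [b [ab e]]] := argmin_set_collision T_neq0 cT.
have bn0 j : beyond T j != set0.
  apply/set0Pn; exists (s j); apply/beyondP => i ij.
  by apply: leq_ltn_trans (s_max ij vs); have [_ ->] := argmin_setP i T_neq0.
by rewrite (card_rooms_on2 T_neq0 cT domT ab e).
Qed.

Lemma rooms_on_T0 : #|rooms_on T0| = 1.
Proof.
have T_neq0 := door_neq0 door_T0; have /andP[/eqP cT _] := door_T0.
have minT i : i != k -> argmin_set T0 i = s i.
  move=> ik; apply: argmin_set_eq => [|x _]; first by rewrite imset_f // !inE.
  by have [->//|/s_min/ltnW] := eqVneq x (s i).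
have domT : dominant T0.
  apply/dominantP => y; have [/codomP[i ->]|ys] := boolP (y \in codom s).
    by exists i => x _; have [->//|/s_min/ltnW] := eqVneq x (s i).
  exists k => _ /imsetP[i ik ->]; apply/ltnW/s_max => //.
  by move: ik; rewrite !inE eq_sym.
have [/imsetP[q qk eq] _] := argmin_setP k T_neq0.
have qk' : q != k by move: qk; rewrite !inE.
apply: (@card_rooms_on1 _ k q) => //.
- by rewrite eq_sym.
- by rewrite eq minT.
- apply/set0Pn; exists v0; apply/beyondP => i ik; rewrite minT //.
  by apply: s_min; apply: contraNneq v0s => ->; apply: codom_f.
(* A point of [beyond T0 q] lies above [s q] in order [k], so it is a slack vector [s j] with [j]
   distinct from [k] and [q]. But in order [j] it would have to exceed [s j], which is itself. *)
apply/eqP; apply: contraT => /set0Pn[y /beyondP yM].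
have := yM k; rewrite eq_sym => /(_ qk'); rewrite eq => ky.
have /codomP[j yj] : y \in codom s.
  by apply: contraT => /(@s_max k q); rewrite eq_sym => /(_ qk'); rewrite ltnNge ltnW.
have jk : j != k.
  apply: contraTneq ky => jk; rewrite yj jk -leqNgt ltnW // s_min //.
  by rewrite (inj_eq s_inj).
have jq : j != q by apply: contraTneq ky => jq; rewrite yj jq ltnn.
by have := yM j jq; rewrite minT // yj ltnn.
Qed.

(* Double count the incidences between doors and dominant rooms: every door
   other than T0 lies in an even number of rooms, and a room that misses a color
   has an even number of doors. *)
Lemma colorful_room : exists2 U, dominant U & c @: U = setT.
Proof.
have [/exists_inP[U dU /eqP cU]|/exists_inPn nU] :=
  boolP [exists U in dominant, c @: U == setT]; first by exists U.
have : ~~ (2 %| \sum_(T | door T) #|rooms_on T|).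
  rewrite (bigD1 T0) ?door_T0 //= rooms_on_T0 dvdn_addl // dvdn_sum //.
  by move=> T /andP[]; apply: even_rooms_on.
move=> /negP[].
rewrite (_ : \sum_(T | door T) _ =
  \sum_(U | dominant U) #|[set x in U | door (U :\ x)]|).
  by apply: dvdn_sum => U /nU; apply: even_doors.
under eq_bigr do rewrite -sum1_card big_mkcond.
under [RHS]eq_bigr do rewrite -sum1_card big_mkcond.
rewrite exchange_big [RHS]exchange_big; apply: eq_bigr => x _ /=.
(* For fixed [x], adding and deleting [x] match doors avoiding [x] with rooms containing it. *)
rewrite -!big_mkcondr /= (reindex_onto (fun U => U :\ x) (fun T => x |: T)) /=.
  apply: eq_bigl => U; rewrite !inE eqxx /=.
  have [xU|xU] := boolP (x \in U); first by rewrite setD1K // eqxx andbT andbC.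
  rewrite andbC andbF; apply/negP => /andP[/eqP e]; move: xU.
  by rewrite -e setU11.
move=> T; rewrite !inE => /andP[_ /andP[xT _]]; exact: setU1K.
Qed.
End Dominance.

(** * From linear orders to integer-valued functions *)

Section SlackVectors.
Import mathcomp.boot.fintype mathcomp.boot.finset.
Local Open Scope set_scope.
Variables (V I : finType) (h : I -> V -> nat).

Definition slack_bound i := ((\max_v h i v).+1 * #|V|).+1.

(* Ranks the disjoint union of the points V, sorted by h i with ties broken by
   the enumeration of V, and of one slack vector per i in I: the i-th slack
   vector is the bottom of the i-th order and lies above V in the others. *)
Definition slack_rank i (x : V + I) : nat :=
  match x with
  | inl v => (h i v * #|V| + enum_rank v).+1
  | inr j => if j == i then 0 else slack_bound i + enum_rank j
  end.

Lemma slack_rank_bound i v : slack_rank i (inl v) < slack_bound i.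
Proof.
rewrite /slack_rank /slack_bound ltnS -addnS addnC mulSn leq_add //.
by rewrite leq_mul2r leq_bigmax orbT.
Qed.

Lemma slack_rank_le i v w :
  slack_rank i (inl v) <= slack_rank i (inl w) -> h i v <= h i w.
Proof.
rewrite /slack_rank ltnS => le; rewrite leqNgt; apply/negP => lt.
have : (h i w).+1 * #|V| <= h i w * #|V| + enum_rank w.
  by apply: leq_trans le; rewrite (leq_trans _ (leq_addr _ _)) // leq_mul2r lt orbT.
by rewrite mulSn addnC leq_add2l leqNgt ltn_ord.
Qed.

Lemma slack_rank_inj i : injective (slack_rank i).
Proof.
move=> [v|j] [w|l] e.
- have hvw : h i v = h i w by apply/eqP; rewrite eqn_leq !slack_rank_le // e.
  move: e; rewrite /= hvw => -[] /addnI/ord_inj/enum_rank_inj->//.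
- have := slack_rank_bound i v; rewrite e /=; move: e; rewrite /=.
  by case: eqP => // _ _; rewrite ltnNge leq_addr.
- have := slack_rank_bound i w; rewrite -e /=; move: e; rewrite /=.
  by case: eqP => // _ _; rewrite ltnNge leq_addr.
- move: e; rewrite /=; case: eqP => [->|_]; case: eqP => [->|_] //.
  by move=> /addnI/ord_inj/enum_rank_inj->.
Qed.

(** In a colorful room, [C] collects the orders whose slack vector is absent, so each color in [C]
    comes from a genuine point. An order witnessing dominance over a genuine point lies in [C], as a
    slack vector present in the room is the bottom of its own order. *)
Lemma colorful_dominating_family (c : V -> I) (v0 : V) : 1 < #|I| ->
  exists (C : {set I}) (sigma : I -> V),
    (forall y, exists2 i, i \in C & forall j, j \in C -> h i y <= h i (sigma j))
    /\ forall j, j \in C -> c (sigma j) = j.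
Proof.
move=> I2; pose c' (x : V + I) := match x with inl v => c v | inr i => i end.
have /card_gt0P[k _] : 0 < #|I| by apply: ltnW.
have inl_codom v : @inl V I v \notin codom inr by apply/negP => /codomP[].
have [|||U /dominantP domU cU] :=
    @colorful_room _ _ slack_rank slack_rank_inj (inl v0) c' k inr (inl v0) _ _
      (inl_codom v0) _ I2.
- move=> i [v|j] /=; rewrite eqxx //.
  by have [->|ji _] := eqVneq j i; rewrite ?eqxx // (negPf ji).
- move=> i j [v|l] ij; last by rewrite codom_f.
  move=> _; apply: leq_trans (slack_rank_bound _ _) _.
  by rewrite /= eq_sym (negPf ij) leq_addr.
- by [].
pose C := [set i | inr i \notin U].
pose sigma j := odflt v0 [pick v | (inl v \in U) && (c v == j)].
have sigmaP j : j \in C -> inl (sigma j) \in U /\ c (sigma j) = j.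
  move=> jC; rewrite /sigma; case: pickP => [v /andP[vU /eqP]//|] none.
  have : j \in c' @: U by rewrite cU.
  case/imsetP => -[v|l] xU /= jx; first by have := none v; rewrite xU jx eqxx.
  by move: jC; rewrite inE jx xU.
exists C, sigma; split=> [y|j /sigmaP[]//].
have [i iP] := domU (inl y); exists i.
  by rewrite inE; apply/negP => /iP; rewrite /= eqxx.
by move=> j /sigmaP[/iP /slack_rank_le].
Qed.
End SlackVectors.

Local Open Scope classical_set_scope.
Local Open Scope ring_scope.

(** * Colorings of integer grids *)

Section SimplexGrid.
Import mathcomp.boot.fintype mathcomp.boot.finset.
Local Open Scope nat_scope.
Local Open Scope set_scope.
Variables m N : nat.

Definition grid := {v : {ffun 'I_m -> 'I_N.+1} | \sum_i v i == N :> nat}.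

Definition grid_coord (i : 'I_m) (v : grid) : nat := val v i.

Lemma sum_grid_coord v : \sum_i grid_coord i v = N.
Proof. by have /eqP := valP v. Qed.

Lemma grid_point (f : 'I_m -> nat) : \sum_i f i = N ->
  exists v : grid, forall i, grid_coord i v = f i.
Proof.
move=> sumf.
have fN i : f i < N.+1 by rewrite ltnS -sumf (bigD1 i) //= leq_addr.
pose u : {ffun 'I_m -> 'I_N.+1} := [ffun i => inord (f i)].
have uE i : u i = f i :> nat by rewrite ffunE inordK.
have sumu : \sum_i u i == N by apply/eqP; under eq_bigr do rewrite uE.
by exists (exist _ u sumu).
Qed.

(** Let [a i] be the least [i]-th coordinate in the dominating family. Domination forces the sum of
    [a] over [C] above [N - m], while every member has total [N]; so no coordinate can exceed its
    lower bound (zero outside [C]) by more than [m]. *)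
Lemma grid_colorful_family (c : grid -> 'I_m) : 1 < m ->
  exists (C : {set 'I_m}) (sigma : 'I_m -> grid),
  [/\ exists j, j \in C, forall j, j \in C -> c (sigma j) = j,
      forall i j l, j \in C -> l \in C ->
        grid_coord i (sigma j) <= grid_coord i (sigma l) + m &
      forall i j, i \notin C -> j \in C -> grid_coord i (sigma j) <= m].
Proof.
move=> m2; pose i0 : 'I_m := Ordinal (ltnW m2).
have [v0 _] : exists v : grid, forall i, grid_coord i v = if i == i0 then N else 0.
  apply: grid_point; by rewrite -big_mkcond big_pred1_eq.
have [|C [sigma [domC cC]]] := @colorful_dominating_family _ _ grid_coord c v0.
  by rewrite card_ord.
have [j0 j0C _] := domC v0; exists C, sigma.
pose a i := grid_coord i (sigma [arg min_(j < j0 in C) grid_coord i (sigma j)]).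
have aP i j : j \in C -> a i <= grid_coord i (sigma j).
  by move=> jC; rewrite /a; case: arg_minnP => // l _; apply.
have a_dom y : exists2 i, i \in C & grid_coord i y <= a i.
  have [i iC iP] := domC y; exists i => //.
  by rewrite /a; case: arg_minnP => // l /iP.
have sum_a : N < \sum_(i in C) (a i).+1.
  rewrite ltnNge; apply/negP => le.
  (* A point beating every [a i] on [C], with the surplus placed on [j0] to reach the total [N]. *)
  pose f i := (if i \in C then (a i).+1 else 0) +
              (if i == j0 then N - \sum_(i in C) (a i).+1 else 0).
  have [y yf] : exists y : grid, forall i, grid_coord i y = f i.
    apply: grid_point; rewrite big_split /= -big_mkcond /= -big_mkcond /= big_pred1_eq.
    by rewrite subnKC.
  have [i iC] := a_dom y.
  by rewrite yf /f iC leqNgt ltnS leq_addr.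
have sum_aC : N < \sum_(i in C) a i + m.
  apply: leq_trans sum_a _; under eq_bigr do rewrite -addn1.
  rewrite big_split /= leq_add2l sum1_card.
  by apply: leq_trans (max_card _) _; rewrite card_ord.
have spread i j : j \in C ->
    grid_coord i (sigma j) <= (if i \in C then a i else 0) + m.
  move=> jC; rewrite -(leq_add2r (\sum_(l in C | l != i) a l)).
  apply: (@leq_trans N).
    rewrite -(sum_grid_coord (sigma j)) [leqRHS](bigD1 i) //= leq_add2l.
    rewrite big_mkcondl; apply: leq_sum => l _; case: ifP => // _; exact: aP.
  apply: leq_trans (ltnW sum_aC) _; case: ifP => iC.
    by rewrite (bigD1 i iC) /= addnAC.
  rewrite add0n addnC leq_add2l; apply: eq_leq; apply: eq_bigl => l.
  by have [->|] := eqVneq l i; rewrite ?iC ?andbT.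
split=> [|//|i j l jC lC|i j iC jC]; first by exists j0.
  apply: leq_trans (spread i j jC) _; rewrite leq_add2r.
  by case: ifP => // _; apply: aP.
by have := spread i j jC; rewrite (negPf iC).
Qed.
End SimplexGrid.

(** * A covering lemma on the simplex *)

Section DualKKM.
Import numFieldNormedType.Exports.
Variables (R : realType) (m : nat).

Definition simplex : set 'rV[R]_m :=
  [set t | (forall i, 0 <= t ord0 i) /\ \sum_i t ord0 i = 1].

Lemma ball_rV (x y : 'rV[R]_m) (e : R) :
  ball x e y <-> 0 < e /\ forall i, `|x ord0 i - y ord0 i| < e.
Proof.
split=> [[e0 H]|[e0 H]]; split => // i; first exact: H.
by move=> j; rewrite ord1; apply: H.
Qed.

Lemma compact_simplex : compact simplex.
Proof.
apply: (@subclosed_compact _ _ [set t : 'rV[R]_m | forall i, `[0, 1]%classic (t ord0 i)]).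
- have -> : simplex = (\bigcap_i [set t : 'rV[R]_m | 0 <= t ord0 i]) `&`
      [set t : 'rV[R]_m | \sum_i t ord0 i = 1].
    apply/seteqP; split=> t [t0 t1]; split=> // i; first by move=> _; apply: t0.
    exact: (t0 i I).
  apply: closedI.
    apply: closed_bigI => i _.
    apply: (@preimage_closed _ _ (fun t : 'rV[R]_m => t ord0 i) [set x | 0 <= x]).
      by move=> t _; apply: coord_continuous.
    exact: closed_ge.
  apply: (@preimage_closed _ _ (fun t : 'rV[R]_m => \sum_i t ord0 i) [set x | x = 1]).
    move=> t _; apply: continuous_big => [|i _]; first exact: add_continuous.
    exact: coord_continuous.
  exact: closed_eq.
- apply: (@rV_compact R m (fun=> `[0, 1]%classic)) => i.
  exact: segment_compact.
- move=> t [t0 t1] i; rewrite /= in_itv /= t0 /= -t1 (bigD1 i) //= lerDl.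
  by apply: sumr_ge0.
Qed.

(** Color each grid point by the index of a set containing it. Indices in [C] have a nearby point of
    their set; the others have a small coordinate. *)
Lemma grid_approximation (A : 'I_m -> set 'rV[R]_m) (e : R) : (1 < m)%N -> 0 < e ->
  simplex `<=` \bigcup_i A i ->
  exists2 t, simplex t & forall i,
    t ord0 i < e \/ exists2 s, A i s & forall l, `|t ord0 l - s ord0 l| < e.
Proof.
move=> m2 e0 cover.
(* On the grid of total [N.+1], an integer error of [m] scales to less than [e]. *)
pose N := Num.truncn (m%:R / e).
have Ne : m%:R / N.+1%:R < e.
  by rewrite ltr_pdivrMr ?ltr0n // mulrC -ltr_pdivrMr // truncnS_gt.
pose p (v : grid m N.+1) : 'rV[R]_m := \row_i ((grid_coord i v)%:R / N.+1%:R).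
have pS v : simplex (p v).
  split=> [i|]; first by rewrite mxE divr_ge0.
  under eq_bigr do rewrite mxE.
  by rewrite -mulr_suml -natr_sum sum_grid_coord divff // pnatr_eq0.
have /choice[c cA] : forall v, exists i, A i (p v).
  by move=> v; have [i _ iA] := cover _ (pS v); exists i.
have [C [sigma [[j jC] cC spread small]]] := grid_colorful_family c m2.
exists (p (sigma j)) => // i; have [iC|iC] := boolP (i \in C); last first.
  left; apply: le_lt_trans Ne; rewrite mxE ler_pM2r ?invr_gt0 ?ltr0n // ler_nat.
  exact: small.
right; exists (p (sigma i)) => [|l]; first by have := cA (sigma i); rewrite cC.
apply: le_lt_trans Ne; rewrite !mxE -mulrBl normrM [`|_^-1|]ger0_norm ?invr_ge0 //.
rewrite ler_pM2r ?invr_gt0 ?ltr0n // ler_norml lerBlDl -natrD ler_nat.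
by rewrite lerNl opprB lerBlDl -natrD ler_nat !spread.
Qed.

Lemma dual_KKM (A : 'I_m -> set 'rV[R]_m) : (1 < m)%N ->
  (forall i, closed (A i)) -> simplex `<=` \bigcup_i A i ->
  exists2 t, simplex t & forall i, 0 < t ord0 i -> A i t.
Proof.
move=> m2 clA cover.
have /choice[u uP] : forall k : nat, exists t, simplex t /\ forall i,
    t ord0 i < k.+1%:R^-1 \/ 
    exists2 s, A i s & forall l, `|t ord0 l - s ord0 l| < k.+1%:R^-1.
  move=> k; have k0 : 0 < k.+1%:R^-1 :> R by rewrite invr_gt0 ltr0n.
  by have [t tS tP] := grid_approximation m2 k0 cover; exists t.
have [|t [tS tcl]] := compact_simplex (F := u @ \oo).
  by exists 0%N => // k _; have [] := uP k.
exists t => // i ti0; apply: clA => B /nbhs_ballP[e /= e0 eB].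
(* The bound [t i / 2] excludes the alternative of a small [i]-th coordinate; [e / 2] leaves room
   for the two distances from [t] to [u k] and on to [s]. *)
pose d := Num.min (e / 2) (t ord0 i / 2).
have d0 : 0 < d by rewrite lt_min !divr_gt0.
have [de dt] : d <= e / 2 /\ d <= t ord0 i / 2 by rewrite !ge_min !lexx orbT.
have near_u : \forall k \near \oo, k.+1%:R^-1 < d.
  exists (Num.truncn d^-1) => // k /= dk; rewrite invf_plt ?posrE ?ltr0n //.
  by apply: lt_le_trans (truncnS_gt _) _; rewrite ler_nat ltnS.
have [x [[k kd <-] /ball_rV[_ ux]]] :
    ((u @` [set k | k.+1%:R^-1 < d]) `&` ball t d) !=set0.
  apply: tcl; last exact: nbhsx_ballx.
  by apply: filterS near_u => k kd; exists k.
have [_ /(_ i)[ui|[s As us]]] := uP k.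
  have := ux i; have := lt_trans ui kd; move: dt => /= dt; rewrite ltr_distl.
  by move=> h1 /andP[_ h2]; exfalso; lra.
exists s; split=> //; apply: eB; apply/ball_rV; split=> // l.
have := ler_distD (u k ord0 l) (t ord0 l) (s ord0 l).
by have := ux l; have := lt_trans (us l) kd; move=> h1 h2 h3; lra.
Qed.

End DualKKM.

(** * The Fan-Browder theorem *)

Section ConvexSum.
Variables (R : realType) (M : lmodType R) (A : set M).
Hypothesis cA : convex_set A.

Lemma convex_set_comb (x y : M) (a b : R) :
  A x -> A y -> 0 <= a -> 0 <= b -> a + b = 1 -> A (a *: x + b *: y).
Proof.
move=> Ax Ay a0 b0 ab.
have a1 : a <= 1 by rewrite -ab lerDl.
have -> : b = 1 - a by rewrite -ab addrAC subrr add0r.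
exact: set_mem (cA (Itv01 a0 a1) (mem_set Ax) (mem_set Ay)).
Qed.

(** Induction on the index list, with each partial sum renormalised to total weight one. Points of
    weight zero may lie outside [A], hence the case splits on vanishing weights. *)
Lemma convex_set_sum (J : finType) (t : J -> R) (y : J -> M) :
  (forall j, 0 <= t j) -> \sum_j t j = 1 -> (forall j, 0 < t j -> A (y j)) ->
  A (\sum_j t j *: y j).
Proof.
move=> t0 t1 Ay.
suff H (r : seq J) : 0 < \sum_(j <- r) t j ->
    A ((\sum_(j <- r) t j)^-1 *: \sum_(j <- r) t j *: y j).
  by have := H (index_enum J); rewrite t1 invr1 scale1r; apply.
elim: r => [|j r IH]; first by rewrite big_nil ltxx.
rewrite !big_cons; set w := \sum_(j <- r) t j in IH *.
set S := \sum_(j <- r) _ in IH *.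
have w0 : 0 <= w by apply: sumr_ge0.
have [tj|tj] := eqVneq (t j) 0; first by rewrite tj scale0r !add0r.
have tj0 : 0 < t j by rewrite lt_neqAle eq_sym tj t0.
have [we|wn] := eqVneq w 0.
  have -> : S = 0.
    apply: big1_seq => l /= lr; apply/eqP; rewrite scaler_eq0; apply/orP; left.
    move/eqP: we; rewrite psumr_eq0 => [/allP/(_ l lr)//|l' _]; exact: t0.
  by rewrite we !addr0 scalerA mulVf // scale1r => _; apply: Ay.
have wp : 0 < w by rewrite lt_neqAle eq_sym wn.
move=> tw; rewrite scalerDr !scalerA.
have -> : (t j + w)^-1 *: S = ((t j + w)^-1 * w) *: (w^-1 *: S).
  by rewrite scalerA mulfK.
apply: convex_set_comb; [exact: Ay|exact: IH| | |].
- by rewrite mulr_ge0 // invr_ge0 ltW.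
- by rewrite mulr_ge0 // invr_ge0 ltW.
- by rewrite -mulrDr mulVf // gt_eqF.
Qed.
End ConvexSum.

Section FanBrowder.
Import numFieldNormedType.Exports.

Lemma compact_finite_subcover (T : topologicalType) (K : set T) (N : T -> set T) :
  compact K -> (forall x, K x -> nbhs x (N x)) ->
  exists s : seq T, (forall x, x \in s -> K x) /\
    forall z, K z -> exists2 x, x \in s & N x z.
Proof.
move=> /compact_near_coveringP cK nbN.
(* The filter of finite lists of points of [K], directed by inclusion, turns the near-covering form
   of compactness into a finite subcover. *)
pose F : set_system (seq T) := [set S | exists s0 : seq T,
  (forall x, x \in s0 -> K x) /\ forall s, {subset s0 <= s} -> S s].
have FF : Filter F.
  split.
  - by exists [::].
  - move=> P Q [s [sK sP]] [s' [s'K s'Q]]; exists (s ++ s'); split.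
      by move=> x; rewrite mem_cat => /orP[/sK|/s'K].
    move=> l sl; split; [apply: sP|apply: s'Q] => x xs; apply: sl.
      by rewrite mem_cat xs.
    by rewrite mem_cat xs orbT.
  - by move=> P Q PQ [s [sK sP]]; exists s; split=> // l /sP/PQ.
have [x Kx|s0 [s0K s0P]] := cK _ F (fun s x => exists2 y, y \in s & N y x) FF.
  exists (N x, [set s | x \in s]) => /=; last by move=> [z s] [/= Nz xs]; exists x.
  split; first exact: nbN.
  exists [:: x]; split => [y|s]; first by rewrite mem_seq1 => /eqP->.
  by apply; rewrite mem_seq1.
by exists s0; split=> // z Kz; apply: (s0P s0).
Qed.

Lemma continuous_into_prod (S : topologicalType) (J : Type)
    (K : J -> topologicalType) (f : S -> prod_topology K) :
  (forall j, continuous (fun x => f x j)) -> continuous f.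
Proof.
move=> cf x; apply/cvg_sup => j.
exact: (@continuous_comp_initial _ _ _ _ f (cf j) x).
Qed.

Variables (R : realType) (I : finType) (n : I -> nat).
Variable X : forall nu : I, set 'rV[R]_(n nu).
Arguments X : clear implicits.
Hypotheses (X_neq0 : forall nu, X nu !=set0) (X_convex : forall nu, convex_set (X nu))
  (X_compact : forall nu, compact (X nu)).

Definition feasible : set (profile R n) := [set x | forall nu, X nu (x nu)].

Lemma compact_feasible : compact feasible.
Proof. exact: (@tychonoff I (fun nu => 'rV[R]_(n nu)) X X_compact). Qed.

(** A finite subcover selects values [yz (p i)], each valid on a closed neighbourhood of [p i]. The
    map [e] sends the simplex to their convex combinations, and the preimages of the closed
    neighbourhoods cover it. The covering lemma gives [t] whose image lies in the [i]-th
    neighbourhood whenever [t i] is positive. *)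
Lemma fan_browder (F : profile R n -> set (profile R n)) :
  (forall z, feasible z ->
     exists2 y, feasible y & \forall z' \near z, feasible z' -> F z' y) ->
  exists (z : profile R n) (m : nat) (t : 'rV[R]_m) (y : 'I_m -> profile R n),
    [/\ feasible z, simplex t, forall i, 0 < t ord0 i -> F z (y i) &
        forall nu, z nu = \sum_i t ord0 i *: y i nu].
Proof.
move=> Fopen.
have /choice[yz yzP] : forall z, exists y, feasible z ->
    feasible y /\ \forall z' \near z, feasible z' -> F z' y.
  move=> z; have [/Fopen[y yf yn]|nz] := pselect (feasible z); first by exists y.
  by exists z.
have /choice[N NP] : forall z, exists N : set (profile R n), feasible z ->
    nbhs z N /\ forall z', closure N z' -> feasible z' -> F z' (yz z).
  move=> z; have [fz|nz] := pselect (feasible z); last by exists setT.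
  by have [_ /uniform_regular[N zN Ncl]] := yzP z fz; exists N.
have [s [sf scover]] : exists s : seq (profile R n),
    (forall x, x \in s -> feasible x) /\
    forall z, feasible z -> exists2 x, x \in s & N x z.
  by apply: (compact_finite_subcover compact_feasible) => x /NP[].
have [x0 x0f] : exists x0, feasible x0.
  by exists (fun nu => projT1 (cid (X_neq0 nu))) => nu; case: cid.
(* Doubling the nonempty list ensures [1 < m], as [dual_KKM] requires. *)
pose l := s ++ s; pose m := size l.
pose p (i : 'I_m) := nth x0 l i.
have pf i : feasible (p i).
  by apply: sf; have := mem_nth x0 (ltn_ord i); rewrite mem_cat orbb.
pose e (t : 'rV[R]_m) : profile R n := fun nu => \sum_i t ord0 i *: yz (p i) nu.
have e_cont : continuous e.
  apply: continuous_into_prod => nu.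
  apply: continuous_big => [|i _]; first exact: add_continuous.
  move=> t; apply: cvgZr_tmp; [exact: nbhs_filter|exact: coord_continuous].
have ef t : simplex t -> feasible (e t).
  move=> [t0 t1] nu; apply: convex_set_sum => // i _.
  by have [+ _] := yzP _ (pf i); apply.
pose A i := e @^-1` closure (N (p i)).
have [|i||t tS tA] := @dual_KKM R m A.
- rewrite /m size_cat; have [x xs _] := scover x0 x0f.
  by case: (s) xs => [//|a r] _; rewrite /= addnS.
- apply: preimage_closed; last exact: closed_closure.
  by move=> t _; apply: e_cont.
- move=> t /ef/scover[x xs Nx].
  have xl : (index x l < m)%N by rewrite index_mem mem_cat xs.
  exists (Ordinal xl) => //; apply: subset_closure.
  by rewrite /p /= nth_index // mem_cat xs.
exists (e t), m, t, (fun i => yz (p i)); split=> //; first exact: ef.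
by move=> i /tA eA; have [_ /(_ (e t) eA)] := NP _ (pf i); apply; apply: ef.
Qed.
End FanBrowder.

(** * Equilibria *)

Section OpenGraph.
Variables (R : realType) (d : nat).

(* Coordinate by coordinate: combining two points on opposite sides of the k-th
   coordinate hyperplane through p gives one on it, in the same orthant for the
   later coordinates. *)
Lemma convex_set_orthants (A : set 'rV[R]_d) (p : 'rV[R]_d) : convex_set A ->
  (forall s : {ffun 'I_d -> bool}, exists2 a, A a & forall i,
     if s i then p ord0 i < a ord0 i else a ord0 i < p ord0 i) -> A p.
Proof.
move=> cA sgnA.
suff H k : (k <= d)%N -> forall s : {ffun 'I_d -> bool}, exists2 a, A a &
    forall i : 'I_d, if (i < k)%N then a ord0 i = p ord0 i else
      if s i then p ord0 i < a ord0 i else a ord0 i < p ord0 i.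
  have [a Aa aP] := H d (leqnn d) [ffun=> true].
  suff <- : a = p by [].
  by apply/rowP => i; have := aP i; rewrite ltn_ord.
elim: k => [|k IH] kd s; first by have [a Aa aP] := sgnA s; exists a.
pose j := Ordinal kd; pose upd b := [ffun i => if i == j then b else s i].
have [x Ax xP] := IH (ltnW kd) (upd true); have [y Ay yP] := IH (ltnW kd) (upd false).
have := xP j; rewrite ltnn ffunE eqxx => xj.
have := yP j; rewrite ltnn ffunE eqxx => yj.
have xyj : 0 < x ord0 j - y ord0 j by rewrite subr_gt0 (lt_trans yj).
pose a := (p ord0 j - y ord0 j) / (x ord0 j - y ord0 j).
pose b := 1 - a.
have aE : a * (x ord0 j - y ord0 j) = p ord0 j - y ord0 j by rewrite divfK ?gt_eqF.
have a0 : 0 < a by rewrite divr_gt0 // subr_gt0.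
have b0 : 0 < b by rewrite subr_gt0 ltr_pdivrMr // mul1r ltrD2r.
have ab : a + b = 1 by rewrite addrC subrK.
exists (a *: x + b *: y); first by apply: convex_set_comb => //; exact: ltW.
move=> i; rewrite !mxE ltnS leq_eqVlt.
have -> : (i == k :> nat) = (i == j) by [].
have pE : p ord0 i = a * p ord0 i + b * p ord0 i by rewrite -mulrDl ab mul1r.
have := xP i; have := yP i; rewrite !ffunE.
have [->|ij] := eqVneq i j; first by rewrite /b => _ _ /=; lra.
rewrite /=; case: ifP => _; first by move=> -> ->.
by case: (s i) => yi xi; rewrite [ltLHS]pE || rewrite [ltRHS]pE;
  rewrite ltrD // ltr_pM2l.
Qed.

Lemma convex_lhc_near_ball (T : topologicalType) (P : T -> set 'rV[R]_d)
    (x : T) (y : 'rV[R]_d) :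
  (forall z, convex_set (P z)) -> open (P x) -> lhc_at setT P x -> P x y ->
  exists2 e, 0 < e & \forall z \near x, ball y e `<=` P z.
Proof.
move=> cP oP lP Pxy.
have /nbhs_ballP[e /= e0 eP] : nbhs y (P x) by exact: open_nbhs_nbhs.
have e4 : 0 < e / 4 by rewrite divr_gt0.
(* The vertices of a cube of half-side [e / 2] around [y]. Points within [e / 4] of them still lie
   in all open orthants around any [p] within [e / 4] of [y]. *)
pose v (s : {ffun 'I_d -> bool}) : 'rV[R]_d :=
  \row_i (y ord0 i + (if s i then e / 2 else - (e / 2))).
have near_v s : \forall z \near x, exists2 a, P z a & ball (v s) (e / 4) a.
  have [||N [xN NP]] := lP (ball (v s) (e / 4))^°; first exact: open_interior.
    exists (v s); split; last exact: nbhsx_ballx.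
    apply: eP; apply/ball_rV; split=> // i; rewrite mxE ltr_distl.
    by case: (s i); lra.
  apply: filterS xN => z /(NP z I)[a [Pa /interior_subset va]].
  by exists a.
exists (e / 4) => //; have := filter_forall (nbhs_filter x) near_v; apply: filterS => z vz p.
move=> /ball_rV[_ py]; apply: convex_set_orthants => // s.
have [a Pa /ball_rV[_ va]] := vz s; exists a => // i.
have := va i; have := py i; rewrite mxE !ltr_distl.
by case: (s i) => /andP[? ?] /andP[? ?]; lra.
Qed.
End OpenGraph.

Lemma near_all_seq (T : topologicalType) (U : eqType) (s : seq U)
    (Q : U -> set T) (z : T) :
  (forall x, x \in s -> \forall z' \near z, Q x z') ->
  \forall z' \near z, forall x, x \in s -> Q x z'.
Proof.
elim: s => [|x s IH] H; first exact: nearW.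
have Hx := H x (mem_head _ _).
have Hs : \forall z' \near z, forall y, y \in s -> Q y z'.
  by apply: IH => y ys; apply: H; rewrite inE ys orbT.
by apply: filterS2 Hx Hs => z' Qx Qs y; rewrite inE => /orP[/eqP->|/Qs].
Qed.

Lemma convex_set_thicken (R : realType) (d : nat) (C : set 'rV[R]_d) (e : R) :
  convex_set C -> convex_set [set y | exists2 k, C k & ball k e y].
Proof.
move=> cC x y l /set_mem[k Ck /ball_rV[e0 kx]] /set_mem[k' Ck' /ball_rV[_ ky]].
have a0 : 0 <= l%:inum by [].
have a1 : 0 <= 1 - l%:inum by rewrite subr_ge0.
set a := l%:inum in a0 a1.
have convE (u v : 'rV[R]_d) : conv l (u : convex_lmodType _) v = a *: u + (1 - a) *: v.
  by [].
apply/mem_set; rewrite convE; exists (a *: k + (1 - a) *: k').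
  by apply: convex_set_comb => //; rewrite addrC subrK.
apply/ball_rV; split=> // i; rewrite !mxE.
have := kx i; have := ky i; move: (k _ _) (k' _ _) (x _ _) (y _ _) => b b' u v vb ub.
have -> : a * b + (1 - a) * b' - (a * u + (1 - a) * v) =
  a * (b - u) + (1 - a) * (b' - v) by lra.
apply: le_lt_trans (ler_normD _ _) _.
rewrite !normrM (ger0_norm a0) (ger0_norm a1).
have [->|an] := eqVneq a 0; first by rewrite mul0r add0r subr0 mul1r.
have ap : 0 < a by rewrite lt_neqAle eq_sym an.
rewrite [ltRHS](_ : e = a * e + (1 - a) * e); last by rewrite -mulrDl addrC subrK mul1r.
by rewrite ltr_leD ?ltr_pM2l // ler_wpM2l // ltW.
Qed.

(** * Local defects and the contradiction *)

Section Equilibrium.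
Variables (R : realType) (I : finType) (n : I -> nat).
Variables (X : forall nu : I, set 'rV[R]_(n nu))
  (pref : forall nu : I, profile R n -> profile R n -> Prop)
  (K : forall nu : I, mprofile R n nu -> set 'rV[R]_(n nu)).
Arguments X : clear implicits.
Arguments pref : clear implicits.
Arguments K : clear implicits.
Hypotheses (K_sub : forall nu w, Xminus X nu w -> K nu w `<=` X nu)
  (X_neq0 : forall nu, X nu !=set0) (X_convex : forall nu, convex_set (X nu))
  (X_compact : forall nu, compact (X nu))
  (K_uhc : forall nu, uhc_on (Xminus X nu) (K nu))
  (K_lhc : forall nu, lhc_on (Xminus X nu) (K nu))
  (K_neq0 : forall nu w, Xminus X nu w -> K nu w !=set0)
  (K_closed : forall nu w, Xminus X nu w -> closed (K nu w))
  (K_convex : forall nu w, Xminus X nu w -> convex_set (K nu w))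
  (U_convex : forall nu x, convex_set (Us (pref nu) nu x))
  (U_open : forall nu x, open (Us (pref nu) nu x))
  (U_lhc : forall nu, lhc_on setT (Us (pref nu) nu)).

Local Notation Z := (feasible X).

Lemma feasible_minus x nu : Z x -> Xminus X nu (minus x nu).
Proof. by move=> Zx j; apply: Zx. Qed.
Arguments feasible_minus [x] nu _.

Lemma minus_continuous nu : continuous (fun x : profile R n => minus x nu).
Proof.
apply: continuous_into_prod => j.
exact: (@proj_continuous I (fun i => 'rV[R]_(n i)) (val j)).
Qed.

Lemma near_K_meets nu x (V : set 'rV[R]_(n nu)) : Z x -> open V ->
  K nu (minus x nu) `&` V !=set0 ->
  \forall z \near x, Z z -> K nu (minus z nu) `&` V !=set0.
Proof.
move=> Zx oV KV; have [N [xN NP]] := K_lhc (feasible_minus nu Zx) oV KV.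
have xN' : \forall z \near x, N (minus z nu) by apply: minus_continuous.
apply: filterS xN' => z Nz /(feasible_minus nu) Zz.
exact: NP.
Qed.

Lemma near_K_sub nu x (V : set 'rV[R]_(n nu)) : Z x -> open V ->
  K nu (minus x nu) `<=` V ->
  \forall z \near x, Z z -> K nu (minus z nu) `<=` V.
Proof.
move=> Zx oV KV; have [N [xN NP]] := K_uhc (feasible_minus nu Zx) oV KV.
have xN' : \forall z \near x, N (minus z nu) by apply: minus_continuous.
apply: filterS xN' => z Nz /(feasible_minus nu) Zz.
exact: NP.
Qed.

Lemma Us_irrefl nu x : ~ Us (pref nu) nu x (x nu).
Proof. by move=> []. Qed.

Lemma near_Us nu x y : Us (pref nu) nu x y ->
  exists2 e, 0 < e & \forall z \near x, ball y e `<=` Us (pref nu) nu z.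
Proof.
by apply: convex_lhc_near_ball => //; apply: U_lhc.
Qed.

Definition improvable nu : set (profile R n) :=
  [set z | K nu (minus z nu) `&` Us (pref nu) nu z !=set0].

(* How a profile fails to be an equilibrium because of player q.1: either
   (q.2 = Some e) his strategy is e-far from his constraint set, or (q.2 = None)
   he has an admissible strictly better reply.  [target q z] is the set towards
   which he should then move. *)
Definition target (q : I * option R) (z : profile R n) : set 'rV[R]_(n q.1) :=
  if q.2 is Some e then [set y | exists2 k, K q.1 (minus z q.1) k & ball k e y]
  else Us (pref q.1) q.1 z.
Arguments target : clear implicits.

Definition defect (q : I * option R) : set (profile R n) :=
  [set z | (if q.2 is Some e then 0 < e else improvable q.1 z) /\
           ~ target q z (z q.1)].

Lemma near_defect x : Z x -> ~ is_GNE X pref K x ->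
  exists q, \forall z \near x, Z z -> defect q z.
Proof.
move=> Zx notE.
have [nu [nK|[y [Ky Uy]]]] : exists nu, ~ K nu (minus x nu) (x nu) \/
    improvable nu x.
- apply: contrapT => /forallNP none; apply: notE; split; first exact: Zx.
  split=> nu; have /not_orP[/contrapT Kx imp] := none nu; first exact: Kx.
  by move=> [y [Ky Uy]]; apply: imp; exists y.
- have /nbhs_ballP[e /= e0 eK] : nbhs (x nu) (~` K nu (minus x nu)).
    apply: open_nbhs_nbhs; split=> //; apply: closed_openC.
    exact: K_closed (feasible_minus nu Zx).
  have e4 : 0 < e / 2 / 2 by rewrite !divr_gt0.
  (* By upper hemicontinuity, nearby constraint sets avoid the closed [e / 2]-ball around [x nu]; a
     nearby strategy moves by less than [e / 4], so a distance of [e / 4] remains. *)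
  exists (nu, Some (e / 2 / 2)).
  have nearK : \forall z \near x, Z z ->
      K nu (minus z nu) `<=` ~` closure (ball (x nu) (e / 2)).
    apply: near_K_sub => //; first exact/closed_openC/closed_closure.
    move=> k Kk /(_ (ball k (e / 2))) [|l [xl kl]].
      by apply: nbhsx_ballx; rewrite divr_gt0.
    exact: (eK k (ball_splitl xl kl)).
  have nearx : \forall z \near x, ball (x nu) (e / 2 / 2) (z nu).
    apply: (@proj_continuous I (fun i => 'rV[R]_(n i)) nu x).
    exact: nbhsx_ballx.
  apply: filterS2 nearK nearx => z Kz xz Zz; split=> // -[k Kk kz].
  apply: (Kz Zz k Kk); apply: subset_closure.
  exact: ball_splitl xz kz.
have [e e0 eU] := near_Us Uy; exists (nu, None).
have nearK : \forall z \near x, Z z ->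
    K nu (minus z nu) `&` (ball y e)^° !=set0.
  apply: near_K_meets => //; first exact: open_interior.
  by exists y; split=> //; apply: nbhsx_ballx.
apply: filterS2 nearK eU => z Kz Uz Zz; split; last exact: Us_irrefl.
by have [k [Kk /interior_subset yk]] := Kz Zz; exists k; split=> //; apply: Uz.
Qed.

Lemma target_convex q z : Z z -> convex_set (target q z).
Proof.
move=> Zz; rewrite /target; case: q.2 => [e|]; last exact: U_convex.
exact/convex_set_thicken/K_convex/feasible_minus.
Qed.

(** For a constraint defect, lower hemicontinuity of [K] keeps a feasible reply within [e] of [y];
    for a preference defect, the open graph keeps [y] strictly better. *)
Lemma near_target q z y : Z z -> defect q z -> K q.1 (minus z q.1) y ->
  (improvable q.1 z -> Us (pref q.1) q.1 z y) ->
  \forall z' \near z, Z z' -> target q z' y.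
Proof.
move=> Zz; rewrite /defect /target; case: q.2 => [e|] [dq _] Ky impU.
  have : \forall z' \near z, Z z' -> K q.1 (minus z' q.1) `&` (ball y e)^° !=set0.
    apply: near_K_meets => //; first exact: open_interior.
    by exists y; split=> //; apply: nbhsx_ballx.
  apply: filterS => z' Kz' /Kz'[k [Kk /interior_subset yk]].
  by exists k => //; apply: ball_sym.
have [e e0 eU] := near_Us (impU dq); apply: filterS eU => z' eU _.
exact/eU/ballxx.
Qed.

(** The same [y] serves every defect at [z] at once, even when several defects blame the same
    player. *)
Lemma best_reply_selection z : Z z -> exists2 y, Z y & forall nu,
  K nu (minus z nu) (y nu) /\ (improvable nu z -> Us (pref nu) nu z (y nu)).
Proof.
move=> Zz.
have sel nu : exists v, K nu (minus z nu) v /\ (improvable nu z -> Us (pref nu) nu z v).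
  have [[v [Kv Uv]]|ni] := pselect (improvable nu z); first by exists v.
  by have [v Kv] := K_neq0 (feasible_minus nu Zz); exists v.
exists (fun nu => projT1 (cid (sel nu))) => nu; case: cid => v [Kv Uv] //=.
exact: K_sub Kv.
Qed.

Lemma exists_GNE : exists x, is_GNE X pref K x.
Proof.
apply: contrapT => /forallNP noE.
have /choice[q qP] : forall x, exists q, Z x -> \forall z \near x, Z z -> defect q z.
  move=> x; have [Zx|nZx] := pselect (Z x).
    by have [q qP] := near_defect Zx (noE x); exists q.
  (* An infeasible profile only needs a default value of [q]; some player exists, since without
     players every profile is feasible. *)
  have [nu _] : exists nu : I, True.
    by apply: contrapT => /forallNP noI; apply: nZx => nu; case: (noI nu).
  by exists (nu, None).
have /choice[N NP] : forall x, exists N : set (profile R n), Z x ->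
    nbhs x N /\ forall z, closure N z -> Z z -> defect (q x) z.
  move=> x; have [Zx|nZx] := pselect (Z x); last by exists setT.
  by have /uniform_regular[N xN Ncl] := qP x Zx; exists N.
have [s [sZ scover]] := compact_finite_subcover (compact_feasible X_compact)
  (fun x Zx => (NP x Zx).1).
(* Closed neighbourhoods make the demands stable: one that does not apply at [z] does not apply near
   [z] either, as the complement of the closure is open. *)
pose F z : set (profile R n) := [set y | forall x, x \in s ->
  closure (N x) z -> target (q x) z (y (q x).1)].
have [|z [m [t [y [Zz [t0 t1] yF zE]]]]] := fan_browder X_neq0 X_convex X_compact (F := F).
  move=> z Zz; have [y Zy yP] := best_reply_selection Zz; exists y => //.
  have : \forall z' \near z, forall x, x \in s -> Z z' -> closure (N x) z' ->
      target (q x) z' (y (q x).1).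
    apply: near_all_seq => x xs; have [_ Nd] := NP x (sZ x xs).
    have [clz|nclz] := pselect (closure (N x) z).
      have [Ky Uy] := yP (q x).1.
      by apply: filterS (near_target Zz (Nd z clz Zz) Ky Uy) => z' + Zz' _; apply.
    have : nbhs z (~` closure (N x)).
      by apply: open_nbhs_nbhs; split=> //; exact/closed_openC/closed_closure.
    by apply: filterS.
  by apply: filterS => z' tz' Zz' x xs; apply: tz'.
have [x xs Nx] := scover z Zz; have [_ Nd] := NP x (sZ x xs).
have clz := subset_closure Nx; have [_] := Nd z clz Zz; apply.
(* The blamed player's strategy is a convex combination of points of the convex target, so it lies
   in the target, against the defect. *)
rewrite zE; apply: convex_set_sum => // [|i ti]; first exact: target_convex.
exact: yF.
Qed.

End Equilibrium.

Theorem theorem3 (R : realType) (I : finType) (n : I -> nat)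
  (X : forall nu : I, set 'rV[R]_(n nu))
  (pref : forall nu : I, profile R n -> profile R n -> Prop)
  (K : forall nu : I, mprofile R n nu -> set 'rV[R]_(n nu))
  (HKmap : forall nu w, Xminus X nu w -> K nu w `<=` X nu)
  (H1 : forall nu, X nu !=set0 /\ convex_set (X nu) /\ compact (X nu))
  (H2cont : forall nu, hcontinuous_on (Xminus X nu) (K nu))
  (H2val : forall nu w, Xminus X nu w ->
     K nu w !=set0 /\ closed (K nu w) /\ convex_set (K nu w))
  (H3 : forall nu (x : profile R n),
     convex_set (Us (pref nu) nu x) /\ open (Us (pref nu) nu x))
  (H4 : forall nu, lhc_on setT (Us (pref nu) nu)) :
  exists xh : profile R n, is_GNE X pref K xh.
Proof.
apply: exists_GNE => //.
- by move=> nu; case: (H1 nu).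
- by move=> nu; have [_ []] := H1 nu.
- by move=> nu; have [_ []] := H1 nu.
- by move=> nu; case: (H2cont nu).
- by move=> nu; case: (H2cont nu).
- by move=> nu w /H2val[].
- by move=> nu w /H2val[_ []].
- by move=> nu w /H2val[_ []].
- by move=> nu x; case: (H3 nu x).
- by move=> nu x; case: (H3 nu x).
Qed.
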